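(* There exists a positive real number $\alpha$ such that for every $\beta>2$ the limit $$\lim_{N\to\infty}\frac{\log Z_N(\alpha;\beta)}{N}$$ exists (as a real number); that is, $\alpha$ has a 1-free energy limit for $\beta>2$.
   Context: Let $A_0=\begin{pmatrix}1&0\\1&1\end{pmatrix}$ and $A_1=\begin{pmatrix}1&1\\0&1\end{pmatrix}$. For a real number $\alpha$, a real number $\beta$ and a positive integer $N$, the Diophantine partition function is $$Z_N(\alpha;\beta)=\sum_{(i_1,\ldots,i_N)\in\{0,1\}^N}\frac{1}{|\alpha q-p|^{\beta}},$$ where $\binom{p}{q}$ denotes the right (second) column of the product $A_{i_1}A_{i_2}\cdots A_{i_N}$. (Equivalently, it is the sum of $|p-\alpha q|^{-\beta}$ over the fractions $p/q\ne 1/0$ of the $N$-th Farey set, obtained from $\{1/0,0/1\}$ by $N$ rounds of inserting mediants $(p+r)/(q+s)$ between neighbours.) For an increasing function $f:\mathbb{N}\to\mathbb{R}^+$, $\alpha$ has an $f(N)$-free energy limit if there is $\beta_c$ such that $\lim_{N\to\infty}\log(Z_N(\alpha;\beta))/f(N)$ exists for all $\beta>\beta_c$; for $f(N)=N^k$ this is called a $k$-free energy limit. *)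

(* Defs.v *)
From mathcomp Require Export all_boot all_order all_algebra.
From mathcomp Require Export all_classical all_reals all_analysis.
Export Order.TTheory GRing.Theory Num.Theory.
Export numFieldNormedType.Exports.

Set Implicit Arguments.
Unset Strict Implicit.
Unset Printing Implicit Defensive.

Local Open Scope ring_scope.

(* A_0 = [[1,0],[1,1]] (b = false) and A_1 = [[1,1],[0,1]] (b = true). *)
Definition farey_mx (b : bool) : 'M[int]_2 :=
  \matrix_(i < 2, j < 2)
    (if i == j then 1 else if (i < j)%N == b then 1 else 0).

(* Matrix multiplication is not commutative: the product is taken in the
   order of w, the first letter being the leftmost factor. *)
Definition farey_prod (w : seq bool) : 'M[int]_2 := \prod_(b <- w) farey_mx b.

Definition farey_num (w : seq bool) : int := farey_prod w 0 1.
Definition farey_den (w : seq bool) : int := farey_prod w 1 1.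

Definition dioph_err (R : realType) (alpha : R) (w : seq bool) : R :=
  alpha * (farey_den w)%:~R - (farey_num w)%:~R.

Definition dioph_Z (R : realType) (alpha beta : R) (N : nat) : R :=
  \sum_(w : N.-tuple bool) (`|dioph_err alpha w| `^ beta)^-1.

(* Since 0^-1 = 0, dioph_Z silently drops the infinite terms that the
   partition function has when some denominator vanishes; this predicate says
   that there are none. *)
Definition dioph_Z_defined (R : realType) (alpha : R) : Prop :=
  forall (N : nat) (w : N.-tuple bool), dioph_err alpha w != 0.

Lemma farey_mx_false :
  [/\ farey_mx false 0 0 = 1, farey_mx false 0 1 = 0,
      farey_mx false 1 0 = 1 & farey_mx false 1 1 = 1].
Proof. by rewrite /farey_mx !mxE. Qed.

Lemma farey_mx_true :
  [/\ farey_mx true 0 0 = 1, farey_mx true 0 1 = 1,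
      farey_mx true 1 0 = 0 & farey_mx true 1 1 = 1].
Proof. by rewrite /farey_mx !mxE. Qed.

(* Main.v *)
Require Import Defs.
From mathcomp Require Import ring lra zify.

Set Implicit Arguments.
Unset Strict Implicit.
Unset Printing Implicit Defensive.

Local Open Scope classical_set_scope.
Local Open Scope ring_scope.

(** Take [alpha] to be the golden ratio [1 + psi], where [psi ^+ 2 = 1 - psi].
Multiplying the row [(-1, alpha)] by [A_1 A_0] gives [psi ^+ 2 *: (-1, alpha)],
whereas multiplying it by [A_0] or by [A_1 A_1] gives a row whose entries have
the same sign, and then all further errors stay bounded away from [0].
Hence [Z_(N+2) = mu * Z_N + O(2 ^ N)] with [mu = psi ^ (- 2 beta)].  For
[beta > 2] we have [mu > 4], so that [Z_N] is of the exact order of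
[mu ^ (N / 2)], and [ln Z_N / N] tends to [ln mu / 2]. *)

(* Second entry of the row [(x, y) *m farey_prod w]. *)
Definition row_err (R : realType) (x y : R) (w : seq bool) : R :=
  x * (farey_num w)%:~R + y * (farey_den w)%:~R.

(** The starting row is left free because stripping the first letter of a word changes it. *)
Definition row_Z (R : realType) (beta x y : R) (N : nat) : R :=
  \sum_(w : N.-tuple bool) (`|row_err x y w| `^ beta)^-1.

Lemma big_tuple_boolS (R : realType) (N : nat) (F : seq bool -> R) :
  \sum_(w : N.+1.-tuple bool) F w =
  \sum_(w : N.-tuple bool) F (false :: w)
  + \sum_(w : N.-tuple bool) F (true :: w).
Proof.
have -> : \sum_(w : N.+1.-tuple bool) F w =
          \sum_(b : bool) \sum_(w : N.-tuple bool) F (b :: w).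
  rewrite pair_big /= (reindex (fun p : bool * N.-tuple bool =>
    [tuple of p.1 :: p.2])) //=.
  exists (fun w => (thead w, [tuple of behead w])) => [[b w] _|w _] /=.
    by rewrite theadE; congr pair; apply: val_inj.
  by rewrite [RHS]tuple_eta.
by rewrite big_bool addrC.
Qed.

Lemma dioph_errE (R : realType) (alpha : R) (w : seq bool) :
  dioph_err alpha w = row_err (-1) alpha w.
Proof. by rewrite /dioph_err /row_err; ring. Qed.

Lemma row_err_nil (R : realType) (x y : R) : row_err x y [::] = y.
Proof.
rewrite /row_err /farey_num /farey_den /farey_prod big_nil !mxE /=.
by rewrite mulr0 add0r mulr1.
Qed.

(** By associativity, the leftmost factor of the product can be absorbed into the row. *)
Lemma row_err_cons (R : realType) (x y : R) (b : bool) (w : seq bool) :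
  row_err x y (b :: w) =
  if b then row_err x (x + y) w else row_err (x + y) y w.
Proof.
rewrite /row_err /farey_num /farey_den /farey_prod big_cons.
set P := \prod_(j <- w) _.
rewrite -mulmxE !mxE !big_ord_recl !big_ord0 /= !addr0.
have -> : lift ord0 ord0 = 1 :> 'I_2 by apply: val_inj.
have [f00 f01 f10 f11] := farey_mx_false.
have [t00 t01 t10 t11] := farey_mx_true.
by case: b; rewrite ?f00 ?f01 ?f10 ?f11 ?t00 ?t01 ?t10 ?t11;
  rewrite !(mul0r, mul1r, add0r, addr0) ?intrD; ring.
Qed.

Lemma row_err_scale (R : realType) (c x y : R) (w : seq bool) :
  row_err (c * x) (c * y) w = c * row_err x y w.
Proof. by rewrite /row_err; ring. Qed.

(** Each letter replaces one entry by the sum of the two, which keeps both entries at least [m]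
    because [m] is positive. *)
Lemma row_err_ge (R : realType) (m x y : R) (w : seq bool) :
  0 < m -> m <= x -> m <= y -> m <= row_err x y w.
Proof.
move=> m0; elim: w x y => [|b w IHw] x y mx my; first by rewrite row_err_nil.
by rewrite row_err_cons; case: b; apply: IHw; lra.
Qed.

Lemma row_Z_recl (R : realType) (beta x y : R) (N : nat) :
  row_Z beta x y N.+1 = row_Z beta (x + y) y N + row_Z beta x (x + y) N.
Proof.
rewrite /row_Z (big_tuple_boolS _ (fun w => (`|row_err x y w| `^ beta)^-1)).
by congr (_ + _); apply: eq_bigr => w _; rewrite row_err_cons.
Qed.

Lemma row_Z_scale (R : realType) (beta c x y : R) (N : nat) :
  row_Z beta (c * x) (c * y) N = (`|c| `^ beta)^-1 * row_Z beta x y N.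
Proof.
rewrite /row_Z mulr_sumr; apply: eq_bigr => w _.
by rewrite row_err_scale normrM powRM // invfM.
Qed.

Lemma row_Z_ge0 (R : realType) (beta x y : R) (N : nat) :
  0 <= row_Z beta x y N.
Proof. by apply: sumr_ge0 => w _; rewrite invr_ge0 powR_ge0. Qed.

Lemma row_Z_le (R : realType) (beta m x y : R) (N : nat) :
  0 <= beta -> 0 < m -> m <= x -> m <= y ->
  row_Z beta x y N <= 2 ^+ N * (m `^ beta)^-1.
Proof.
move=> b0 m0 mx my.
have -> : 2 ^+ N * (m `^ beta)^-1 =
          \sum_(w : N.-tuple bool) (m `^ beta)^-1.
  by rewrite sumr_const card_tuple card_bool -[RHS]mulr_natl natrX.
apply: ler_sum => w _.
have mw := row_err_ge w m0 mx my.
have w0 : 0 < row_err x y w by apply: lt_le_trans mw.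
rewrite lef_pV2 ?posrE ?powR_gt0 ?normr_gt0 ?gt_eqF //.
by rewrite gtr0_norm // ge0_ler_powR ?nnegrE // ltW.
Qed.

(** Strong induction on the length: the prefix [true, false] restores the starting row up to a
    factor and leaves a word two letters shorter; the other two-letter prefixes lead to entries of
    equal sign, where [row_err_ge] applies. *)
Lemma golden_err_neq0 (R : realType) (psi : R) (w : seq bool) :
  0 < psi < 1 -> psi ^+ 2 = 1 - psi -> row_err (-1) (1 + psi) w != 0.
Proof.
move=> /andP[p0 p1] psi2.
have [n] := ubnP (size w); elim: n w => // n IHn [|[] [|[] w]] /= sz.
- by rewrite row_err_nil gt_eqF //; lra.
- by rewrite row_err_cons row_err_nil gt_eqF //; lra.
- rewrite !row_err_cons.
  have -> : row_err (-1) (-1 + (-1 + (1 + psi))) w =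
            -1 * row_err 1 (1 - psi) w.
    by rewrite -row_err_scale; congr row_err; ring.
  have h : 0 < 1 - psi by lra.
  rewrite mulN1r oppr_eq0 gt_eqF //; apply: (lt_le_trans h).
  by apply: row_err_ge; lra.
- rewrite !row_err_cons.
  have -> : row_err (-1 + (-1 + (1 + psi))) (-1 + (1 + psi)) w =
            psi ^+ 2 * row_err (-1) (1 + psi) w.
    by rewrite -row_err_scale; congr row_err; ring: psi2.
  apply: mulf_neq0; first by rewrite expf_neq0 // gt_eqF.
  by apply: IHn; lia.
- by rewrite row_err_cons row_err_nil gt_eqF //; lra.
all: rewrite row_err_cons /= gt_eqF //; apply: (lt_le_trans p0);
  by apply: row_err_ge => //; lra.
Qed.

(** Words are split by prefix: [true, false] scales the row by [psi ^+ 2] and gives the first term;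
    [false] leads to the row [(psi, 1 + psi)] with [N.+1] letters left, and [true, true] to minus
    [(1, 1 - psi)] with [N] letters left. *)
Lemma golden_Z_recl (R : realType) (beta psi : R) (N : nat) :
  0 < psi -> psi ^+ 2 = 1 - psi ->
  row_Z beta (-1) (1 + psi) N.+2 =
  (psi `^ beta) ^- 2 * row_Z beta (-1) (1 + psi) N
  + (row_Z beta psi (1 + psi) N.+1 + row_Z beta 1 (1 - psi) N).
Proof.
move=> p0 psi2.
rewrite row_Z_recl (row_Z_recl _ (-1)).
have -> : -1 + (1 + psi) = psi by ring.
have -> : row_Z beta (-1) (-1 + psi) N = row_Z beta 1 (1 - psi) N.
  have -> : -1 + psi = -1 * (1 - psi) by ring.
  rewrite -{1}[-1]mulr1 row_Z_scale normrN1.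
  by rewrite powR1 invr1 mul1r.
have -> : row_Z beta (-1 + psi) psi N =
          row_Z beta (psi ^+ 2 * -1) (psi ^+ 2 * (1 + psi)) N.
  by congr row_Z; ring: psi2.
rewrite row_Z_scale ger0_norm ?exprn_ge0 ?ltW // expr2 powRM ?ltW //.
by rewrite -expr2; ring.
Qed.

Lemma ln_growth_cvg (R : realType) (u : nat -> R) (c K s : R) :
  0 < c -> 0 < K -> 0 < s ->
  (forall N, c * s ^+ N <= u N <= K * s ^+ N) ->
  (ln (u N) / N%:R) @[N --> \oo] --> ln s.
Proof.
move=> c0 K0 s0 ub.
have cvg_aux (a : R) : (a / N%:R + ln s) @[N --> \oo] --> ln s.
  rewrite -[X in _ --> X]add0r; apply: cvgD; last exact: cvg_cst.
  rewrite -(mulr0 a); apply: cvgM; first exact: cvg_cst.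
  apply/gtr0_cvgV0; last exact: cvgr_idn.
  by near=> n; rewrite ltr0n; near: n; exact: nbhs_infty_gt.
apply: (squeeze_cvgr _ (cvg_aux (ln c)) (cvg_aux (ln K))).
near=> N.
(* At [N = 0] division returns 0, and [lnE] below would fail. *)
have N0 : (0 < N)%N by near: N; exact: nbhs_infty_gt.
have N0R : 0 < N%:R :> R by rewrite ltr0n.
have lnE (a : R) : 0 < a -> ln a / N%:R + ln s = ln (a * s ^+ N) / N%:R.
  move=> a0; rewrite lnM ?posrE ?exprn_gt0 // lnXn // -mulr_natr.
  by field; rewrite gt_eqF.
have /andP[lo hi] := ub N.
have sN := exprn_gt0 N s0.
have lo0 : 0 < c * s ^+ N by rewrite mulr_gt0.
have u0 := lt_le_trans lo0 lo.
rewrite !lnE // !ler_pM2r ?invr_gt0 // !ler_ln ?posrE ?lo ?hi //.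
by rewrite mulr_gt0.
Unshelve. all: by end_near.
Qed.

(** The recursion skips an index, so the induction carries two consecutive bounds. *)
Lemma le_two_step (R : realType) (u : nat -> R) (K s : R) :
  0 <= s -> u 0%N <= K -> u 1%N <= K * s ->
  (forall N, u N.+2 <= s ^+ 2 * u N) -> forall N, u N <= K * s ^+ N.
Proof.
move=> s0 u0 u1 uS N.
suff: u N <= K * s ^+ N /\ u N.+1 <= K * s ^+ N.+1 by case.
elim: N => [|N [IH1 IH2]]; first by rewrite expr0 mulr1 expr1.
split=> //; apply: le_trans (uS N) _.
have -> : K * s ^+ N.+2 = s ^+ 2 * (K * s ^+ N) by rewrite !exprS; ring.
by rewrite ler_wpM2l ?exprn_ge0.
Qed.

(** The term [D * 2 ^+ N] is absorbed by passing to [v N = u N + A * 2 ^+ N]: the choice of [A]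
    makes [D + 4 * A = s ^+ 2 * A], so [v] satisfies [v N.+2 <= s ^+ 2 * v N]. Here [s > 2] makes
    [A] nonnegative, whence [u <= v]. *)
Lemma two_step_growth (R : realType) (u : nat -> R) (s D : R) :
  2 < s -> 0 <= D -> (forall N, 0 < u N) ->
  (forall N, s ^+ 2 * u N <= u N.+2 <= s ^+ 2 * u N + D * 2 ^+ N) ->
  exists c K : R, [/\ 0 < c, 0 < K &
    forall N, c * s ^+ N <= u N <= K * s ^+ N].
Proof.
move=> s2 D0 u0 uS.
have s0 : 0 < s by lra.
have s4 : 0 < s ^+ 2 - 4 by nra.
pose A := D / (s ^+ 2 - 4).
have A0 : 0 <= A by apply: divr_ge0 => //; exact: ltW.
have AE : A * s ^+ 2 = D + 4 * A by rewrite /A; field; rewrite gt_eqF.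
pose v N := u N + A * 2 ^+ N.
(* Even and odd indices evolve separately, so the constants compare the normalised values at 0 and
   1. *)
pose c := Num.min (u 0%N) (u 1%N / s).
pose K := Num.max (v 0%N) (v 1%N / s).
have v0 : 0 < v 0%N by rewrite ltr_pwDl // mulr_ge0 ?exprn_ge0.
exists c, K; split.
- by rewrite lt_min u0 divr_gt0.
- by rewrite lt_max v0.
move=> N; apply/andP; split.
  (* The lower bound for [u] is the upper bound for [- u] with constant [- c]. *)
  rewrite -lerN2 -mulNr.
  apply: (@le_two_step R (fun N => - u N)); first exact: ltW.
  - by rewrite lerN2 ge_min lexx.
  - by rewrite mulNr lerN2 -ler_pdivlMr // ge_min lexx orbT.
  - by move=> n; rewrite mulrN lerN2; have /andP[] := uS n.
have vN : v N <= K * s ^+ N.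
  apply: le_two_step => //; first exact: ltW.
  - by rewrite le_max lexx.
  - by rewrite -ler_pdivrMr // le_max lexx orbT.
  - move=> n; have /andP[_ hi] := uS n; rewrite /v.
    have -> : s ^+ 2 * (u n + A * 2 ^+ n) =
              s ^+ 2 * u n + D * 2 ^+ n + A * 2 ^+ n.+2.
      by rewrite mulrDr mulrA [s ^+ 2 * A]mulrC AE !exprS; ring.
    by rewrite lerD2r.
by apply: le_trans vN; rewrite /v lerDl mulr_ge0 ?exprn_ge0.
Qed.

Theorem theorem4p2 (R : realType) :
  exists alpha : R,
    [/\ 0 < alpha,
        dioph_Z_defined alpha
      & forall beta : R, 2 < beta ->
          exists l : R,
            (ln (dioph_Z alpha beta N) / N%:R) @[N --> \oo] --> l].
Proof.
pose psi : R := (Num.sqrt 5 - 1) / 2.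
have sq5 : Num.sqrt 5 ^+ 2 = 5 :> R by rewrite sqr_sqrtr.
have sq0 : 0 <= Num.sqrt 5 :> R by exact: sqrtr_ge0.
have psi2 : psi ^+ 2 = 1 - psi by rewrite /psi; field: sq5.
have psi_gt : 1 / 2 < psi by rewrite /psi; nra.
have psi_lt : psi < 1 by rewrite /psi; nra.
have psi01 : 0 < psi < 1 by apply/andP; split; lra.
have psi0 : 0 < psi by lra.
have Z0 N (w : N.-tuple bool) : dioph_err (1 + psi) w != 0.
  by rewrite dioph_errE golden_err_neq0.
exists (1 + psi); split=> //; first by lra.
move=> beta beta2.
have b0 : 0 <= beta by lra.
have ZE N : dioph_Z (1 + psi) beta N = row_Z beta (-1) (1 + psi) N.
  by apply: eq_bigr => w _; rewrite dioph_errE.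
have Zgt0 N : 0 < dioph_Z (1 + psi) beta N.
  (* One strictly positive term suffices; the all-[false] word provides it. *)
  rewrite /dioph_Z (bigD1 [tuple of nseq N false]) //= ltr_pwDl //.
    by rewrite invr_gt0 powR_gt0 // normr_gt0 (Z0 N [tuple of nseq N false]).
  by apply: sumr_ge0 => w _; rewrite invr_ge0 powR_ge0.
pose s := (psi `^ beta)^-1.
have pb0 : 0 < psi `^ beta by rewrite powR_gt0.
have s2 : 2 < s.
  (* The threshold on [beta] enters here: [psi < 1] gives an upper bound [psi ^+ 2 = 1 - psi], which
     is below [1 / 2]. *)
  have : psi `^ beta < 1 / 2.
    apply: (@le_lt_trans _ _ (psi `^ 2)).
      by apply: ger_powR; [rewrite psi0 ltW | exact: ltW].
    by rewrite powR_mulrn ?ltW // psi2; lra.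
  by rewrite div1r /s => h; rewrite -[2]invrK ltf_pV2 ?posrE ?invr_gt0.
(* [m] is the least entry of the rows [(psi, 1 + psi)] and [(1, 1 - psi)], as [psi > 1 / 2]; the 3
   in [D] is 2 + 1, from [2 ^+ N.+1] words for the former row and [2 ^+ N] for the latter. *)
pose m := 1 - psi.
pose D := 3 * (m `^ beta)^-1.
have D0 : 0 <= D by rewrite mulr_ge0 // invr_ge0 powR_ge0.
have [|c [K [c0 K0 bnd]]] := two_step_growth s2 D0 Zgt0.
  move=> N; rewrite !ZE golden_Z_recl // -exprVn -/s.
  rewrite lerDl addr_ge0 ?row_Z_ge0 //= lerD2l.
  have m0 : 0 < m by rewrite /m; lra.
  have h1 : row_Z beta psi (1 + psi) N.+1 <= 2 ^+ N.+1 * (m `^ beta)^-1.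
    by apply: row_Z_le => //; rewrite /m; lra.
  have h2 : row_Z beta 1 (1 - psi) N <= 2 ^+ N * (m `^ beta)^-1.
    by apply: row_Z_le => //; rewrite /m; lra.
  apply: le_trans (lerD h1 h2) _.
  by rewrite le_eqVlt; apply/orP; left; apply/eqP; rewrite /D exprS; ring.
exists (ln s).
by apply: (ln_growth_cvg c0 K0 _ bnd); lra.
Qed.
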